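(* The following is in the $\Omega$-cluster: a functional that on input a singular $f\in BV$ outputs $x,y\in[0,1]$, which satisfy $f(x)\ne f(y)$ in case $f\notin AC$.
   Context: $BV$ is the class of $f:[0,1]\to\mathbb R$ for which there is $k_0\in\mathbb N$ with $\sum_i|f(x_i)-f(x_{i+1})|\le k_0$ for every partition of $[0,1]$. $f$ is singular if it has zero derivative almost everywhere on $[0,1]$. $AC$ is the class of absolutely continuous $f:[0,1]\to\mathbb R$: for every $k\in\mathbb N$ there is $N\in\mathbb N$ such that for every finite sequence of pairwise disjoint sub-intervals $(x_i,y_i)$ of $[0,1]$ with $\sum_i(y_i-x_i)<2^{-N}$, we have $\sum_i|f(y_i)-f(x_i)|<2^{-k}$. $\Omega$-cluster: $\Omega(X)$ is defined for $X\subset[0,1]$ with $|X|\le 1$ and outputs a finite sequence that includes all elements of $X$. The $\Omega$-cluster is the class of partial functionals $\Phi$ computationally equivalent to $\Omega$ modulo $\exists^2$, i.e. $\Phi$ is computable in $\Omega$ and $\exists^2$, and $\Omega$ is computable in $\Phi$ and $\exists^2$. A description of a functional that does not determine it uniquely defines a class of functionals; such a class is in the $\Omega$-cluster if $\Omega$ is computable, modulo $\exists^2$, in all elements of the class and at least one element of the class is in the $\Omega$-cluster. Here $\exists^2:\mathbb N^{\mathbb N}\to\{0,1\}$ satisfies $\exists^2(f)=0$ iff $f(n)=0$ for some $n$. Representations: reals are fast-converging Cauchy sequences of rationals ($|q_n-q_{n+i}|<2^{-n}$); functions on the reals are functionals respecting equality of reals; sets are given by characteristic functions. Computability: Kleene's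 S1–S9, where partial functionals of type rank $\le 3$ (taking only total arguments, possibly undefined) are allowed as oracles. That is, $\{e\}(\vec\phi)\simeq a$ is the least relation closed under Kleene's schemes: successor, constants, projection to a number argument, composition, primitive recursion, permutation of arguments, application of an argument, and S9: $\{e\}(m,\vec\phi,\vec\psi)\simeq\{m\}(\vec\phi)$. An application of $\phi_i$ to functionals $\lambda\vec\xi.\{d\}(\vec\xi,\vec\phi)$ has a value iff these functionals are total and $\phi_i$ is defined on them. A partial functional $\psi$ is computable in $\vec\phi$ if for some $e$, $\{e\}(\vec\xi,\vec\phi)\simeq\psi(\vec\xi)$ for all total $\vec\xi$ for which $\psi(\vec\xi)$ is defined. Functionals with outputs coded in $\mathbb N^{\mathbb N}$ are viewed as $\mathbb N$-valued with an extra number argument. *)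

(* Defs.v *)
From mathcomp Require Import all_boot all_order all_algebra.
From mathcomp Require Import all_classical all_reals all_analysis.

Set Implicit Arguments.
Unset Strict Implicit.
Unset Printing Implicit Defensive.

Import Order.TTheory GRing.Theory Num.Theory.
Import numFieldNormedType.Exports.

(* [Ar [:: s_1; ...; s_k]] is the type of the (curried) functionals
   s_1 -> ... -> s_k -> nat, so [Ar [::]] is the type of natural numbers. *)
Inductive ftype : Type := Ar of seq ftype.

Definition ty0 : ftype := Ar [::].
Definition ty1 : ftype := Ar [:: ty0].

Fixpoint rank (s : ftype) : nat :=
  let: Ar l := s in foldr (fun t n => maxn (rank t).+1 n) 0 l.

Fixpoint tfun (s : ftype) : Type :=
  let: Ar l := s in foldr (fun t U => tfun t -> U) nat l.

Definition curried (l : seq ftype) (T : Type) : Type :=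
  foldr (fun t U => tfun t -> U) T l.

(* Partial functionals take total arguments; [None] means "undefined". *)
Definition partial (l : seq ftype) : Type := curried l (option nat).

Fixpoint vals (l : seq ftype) : Type :=
  if l is t :: l' then (tfun t * vals l')%type else unit.

Fixpoint ap (T : Type) (l : seq ftype) : curried l T -> vals l -> T :=
  if l is t :: l' then fun F xs => ap (F xs.1) xs.2 else fun y _ => y.

Fixpoint to_partial (l : seq ftype) : curried l nat -> partial l :=
  if l is t :: l' then fun F x => to_partial (F x) else fun n => Some n.

Record arg : Type := Arg { arg_dom : seq ftype; arg_val : partial arg_dom }.

Definition total_arg (s : ftype) : tfun s -> arg :=
  let: Ar l := s in fun x => Arg (@to_partial l x).

Definition nat_arg (n : nat) : arg := @Arg [::] (Some n).

Fixpoint args_of (l : seq ftype) : vals l -> seq arg :=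
  if l is t :: l' then fun xs => total_arg xs.1 :: args_of xs.2
  else fun _ => [::].

(* Sequence numbers <n_1, ..., n_k>; [CodeSeq.code] is a bijection from
   [seq nat] to [nat]. *)
Local Notation code := CodeSeq.code.

(* [kleene e phi a] is {e}(phi) ~ a.  In [S8], the arguments of the functional
   phi_i are total functionals x_j = lambda xi, {d_j}(xi, phi), one index d_j
   for each argument; [kleene_args ds xs phi] expresses these equalities. *)
Inductive kleene : nat -> seq arg -> nat -> Prop :=
| S1 n phi : kleene (code [:: 1]) (nat_arg n :: phi) n.+1
| S2 q phi : kleene (code [:: 2; q]) phi q
| S3 n phi : kleene (code [:: 3]) (nat_arg n :: phi) n
| S4 e0 e1 phi b a :
    kleene e1 phi b -> kleene e0 (nat_arg b :: phi) a ->
    kleene (code [:: 4; e0; e1]) phi a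
| S5_0 e0 e1 phi a :
    kleene e0 phi a -> kleene (code [:: 5; e0; e1]) (nat_arg 0 :: phi) a
| S5_S e0 e1 n phi b a :
    kleene (code [:: 5; e0; e1]) (nat_arg n :: phi) b ->
    kleene e1 (nat_arg n :: nat_arg b :: phi) a ->
    kleene (code [:: 5; e0; e1]) (nat_arg n.+1 :: phi) a
| S6 d (p : seq nat) phi a :
    perm_eq p (iota 0 (size phi)) ->
    kleene d (pmap (onth phi) p) a ->
    kleene (code [:: 6, d & p]) phi a
| S8 i ds l (F : partial l) (xs : vals l) phi a :
    onth phi i = Some (Arg F) -> kleene_args ds xs phi -> ap F xs = Some a ->
    kleene (code [:: 8, i & ds]) phi a
| S9 k m phi a :
    k <= size phi -> kleene m (take k phi) a ->
    kleene (code [:: 9; k]) (nat_arg m :: phi) a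
with kleene_args : seq nat -> forall l : seq ftype, vals l -> seq arg -> Prop :=
| kleene_args_nil phi : @kleene_args [::] [::] tt phi
| kleene_args_cons d ds l (x : tfun (Ar l)) l' (xs : vals l') phi :
    (forall xi : vals l, kleene d (args_of xi ++ phi) (ap x xi)) ->
    kleene_args ds xs phi ->
    @kleene_args (d :: ds) (Ar l :: l') (x, xs) phi.

(* The index may compute more than [psi]: values are only required where
   [psi] is defined. *)
Definition computable_in (l : seq ftype) (psi : partial l) (phi : seq arg) :=
  exists e : nat, forall (xi : vals l) (a : nat),
    ap psi xi = Some a -> kleene e (args_of xi ++ phi) a.

Definition exists2F (f : nat -> nat) : nat :=
  if `[< exists n, f n = 0 >] then 0 else 1.

Definition exists2_arg : arg := @total_arg (Ar [:: ty1]) exists2F.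

Definition dec_rat (k : nat) : rat :=
  let c := CodeSeq.decode k in
  (((nth 0 c 0)%:R - (nth 0 c 1)%:R) / (nth 0 c 2).+1%:R)%R.

Local Open Scope classical_set_scope.
Local Open Scope ring_scope.

Definition names_real (R : realType) (q : nat -> nat) (x : R) : Prop :=
  (forall n i : nat,
     `|dec_rat (q n) - dec_rat (q (n + i)%N)| < 2%:R ^- n) /\
  (ratr (dec_rat (q n)) : R) @[n --> \oo] --> x.

(* Codes are unconstrained on sequences that name no element of [0, 1], and
   the values of [f] outside [0, 1] play no role. Since [f] is a function on
   [R], its code respects equality of reals. *)
Definition names_fun01 (R : realType) (F : (nat -> nat) -> nat -> nat)
    (f : R -> R) : Prop :=
  forall (q : nat -> nat) (x : R),
    0 <= x <= 1 -> names_real q x -> names_real (F q) (f x).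

Definition names_set01 (R : realType) (F : (nat -> nat) -> nat)
    (X : set R) : Prop :=
  forall (q : nat -> nat) (x : R),
    0 <= x <= 1 -> names_real q x -> F q = nat_of_bool `[< X x >].

Definition component (g : nat -> nat) (i n : nat) : nat := g (code [:: i; n]).

(* [code [::]] is 0, which is not of the form [code [:: i; n]]. *)
Definition names_seq (R : realType) (g : nat -> nat) (s : seq R) : Prop :=
  g (code [::]) = size s /\
  forall i : nat, (i < size s)%N -> names_real (component g i) s`_i.

Definition names_pair (R : realType) (g : nat -> nat) (x y : R) : Prop :=
  names_real (component g 0) x /\ names_real (component g 1) y.

(* Codes of subsets of [0, 1] have type 1 -> 0, codes of functions on [0, 1]
   have type 1 -> 0 -> 0; the last argument, of type 0, makes up for the output
   being a sequence of natural numbers. *)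
Definition set_to_seq : seq ftype := [:: Ar [:: ty1]; ty0].
Definition fun_to_seq : seq ftype := [:: Ar [:: ty1; ty0]; ty0].

Definition is_Omega (R : realType) (Om : partial set_to_seq) : Prop :=
  forall (X : set R) (F : (nat -> nat) -> nat),
    X `<=` `[0, 1]%classic -> is_subset1 X -> names_set01 F X ->
    exists (g : nat -> nat) (s : seq R),
      (forall n, Om F n = Some (g n)) /\ names_seq g s /\ X `<=` [set` s].

Definition Omega_computable_in (R : realType) (l : seq ftype)
    (Phi : partial l) : Prop :=
  exists Om : partial set_to_seq,
    is_Omega R Om /\ computable_in Om [:: Arg Phi; exists2_arg].

(* Omega is itself described up to the choice of the finite sequence:
   "computable in Omega" means in every such functional, "Omega is computable"
   means that some such functional is. *)
Definition in_Omega_cluster (R : realType) (l : seq ftype)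
    (Phi : partial l) : Prop :=
  [/\ (rank (Ar l) <= 3)%N,
      forall Om : partial set_to_seq, is_Omega R Om ->
        computable_in Phi [:: Arg Om; exists2_arg]
    & Omega_computable_in R Phi].

Definition class_in_Omega_cluster (R : realType) (l : seq ftype)
    (C : partial l -> Prop) : Prop :=
  (forall Phi, C Phi -> Omega_computable_in R Phi) /\
  (exists2 Phi, C Phi & in_Omega_cluster R Phi).

(* [f] is read as a function on [0, 1]; the two-sided derivative at 0 and 1 is
   immaterial as {0, 1} is negligible. *)
Definition singular01 (R : realType) (f : R -> R) : Prop :=
  {ae @lebesgue_measure R, forall x : R, x \in `[0, 1] ->
     is_derive x 1 f 0}.

Definition AC01 (R : realType) (f : R -> R) : Prop :=
  forall k : nat, exists N : nat, forall (n : nat) (x y : 'I_n -> R),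
    (forall i, 0 <= x i /\ x i < y i /\ y i <= 1) ->
    trivIset [set: 'I_n] (fun i => `]x i, y i[%classic) ->
    \sum_i (y i - x i) < 2%:R ^- N ->
    \sum_i `|f (y i) - f (x i)| < 2%:R ^- k.

Definition singular_BV_separator (R : realType)
    (Phi : partial fun_to_seq) : Prop :=
  forall (f : R -> R) (F : (nat -> nat) -> nat -> nat),
    names_fun01 F f -> bounded_variation 0 1 f -> singular01 f ->
    exists (g : nat -> nat) (x y : R),
      [/\ forall n, Phi F n = Some (g n), names_pair g x y,
          0 <= x <= 1, 0 <= y <= 1 & ~ AC01 f -> f x <> f y].

(* Main.v *)
Require Import Defs.
From mathcomp Require Import all_boot all_order all_algebra.
From mathcomp Require Import all_classical all_reals all_analysis.
From mathcomp Require Import ring lra zify.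

(* A separator computes an Omega: applied to the indicator function of a set X
   with at most one element, which is singular and of bounded variation, and
   not absolutely continuous if X is nonempty, it yields two points one of which
   is the element of X.
   Conversely, let f be of bounded variation. If f is not constant on the
   rationals of [0, 1], a rational r with f r <> f 0 is found by search.
   Otherwise let X_r be the set of the x in [0, 1] such that the rational r lies
   strictly between f 0 and f x. Between two elements of X_r there is a rational,
   where f takes the value f 0, so that the total variation of f on [0, x]
   increases by at least |r - f 0| from one element x of X_r to a larger one;
   hence X_r is well-ordered. Whether X_r has an element below p is then computed
   by recursion: the elements q < p of X_r with no element of X_r below q form a
   set with at most one element, and Omega lists it. This decides nonemptiness
   of X_r and gives the binary digits of its least element, which do not depend
   on the choice of Omega. *)

Set Implicit Arguments.
Unset Strict Implicit.
Unset Printing Implicit Defensive.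

Import Order.TTheory GRing.Theory Num.Theory.
Import numFieldNormedType.Exports.

Local Notation code := CodeSeq.code.
Local Notation decode := CodeSeq.decode.

(* Codes are unary numbers of iterated exponential size. *)
Local Opaque CodeSeq.code.

(** * Computations in a context *)

(* A context is a family of argument lists of a common length; programs have
   to converge on the points of its domain only. *)
Record ctx := Ctx {
  pt :> Type;
  dom : pt -> Prop;
  env : pt -> seq arg;
  len : nat;
  size_env : forall t, size (env t) = len;
  has_exists2 : exists i, forall t, onth (env t) i = Some exists2_arg }.
Arguments dom {c} t.
Arguments env {c} t.

(** One index serves all points of the domain, so computability is uniform in the parameters;
    nothing is claimed outside the domain. *)
Definition cpt (C : ctx) (f : C -> nat) :=
  exists e, forall t : C, dom t -> kleene e (env t) (f t).

(* As in the convention for [exists2F], 0 stands for true. *)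
Definition dcd (C : ctx) (P : C -> Prop) :=
  cpt (fun t => if `[< P t >] then 0 else 1).

(** Only the domain shrinks, not the argument lists, so an index for a subcontext can be run
    unchanged as a branch or a continuation. *)
Definition subctx (C : ctx) (P : C -> Prop) : ctx :=
  @Ctx C (fun t => dom t /\ P t) (@env C) (len C) (@size_env C)
    (has_exists2 C).

Program Definition extend (C : ctx) (A : Type) (g : A -> arg) : ctx :=
  @Ctx (A * C) (fun t => dom t.2) (fun t => g t.1 :: env t.2) (len C).+1 _ _.
Next Obligation. by move=> C A g [a t] /=; rewrite size_env. Qed.
Next Obligation. by move=> C A g; have [i Hi] := has_exists2 C; exists i.+1 => -[]. Qed.

Local Notation consN C := (extend C nat_arg).
Local Notation consF C := (extend C (@total_arg ty1 : (nat -> nat) -> arg)).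

(** The form in which sequences are passed to oracles: S8 abstracts the extra number argument at the
    head. *)
Definition cpt1 (C : ctx) (q : C -> nat -> nat) :=
  @cpt (consN C) (fun t => q t.2 t.1).

Implicit Types C : ctx.

(** * Closure of computability under the basic schemes *)

Lemma cpt_ext C (f g : C -> nat) :
  (forall t, dom t -> f t = g t) -> cpt f -> cpt g.
Proof. by move=> fg [e He]; exists e => t Dt; rewrite -fg//; apply: He. Qed.

Lemma dcd_ext C (P Q : C -> Prop) :
  (forall t, dom t -> P t <-> Q t) -> dcd P -> dcd Q.
Proof.
move=> PQ; apply: cpt_ext => t Dt; congr (if _ then _ else _).
exact: asbool_equiv_eq (PQ t Dt).
Qed.

Lemma cpt_restrict C (P : C -> Prop) (f : C -> nat) :
  cpt f -> @cpt (subctx P) f.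
Proof. by move=> [e He]; exists e => t [Dt _]; apply: He. Qed.

Lemma cpt_const C n : @cpt C (fun=> n).
Proof. by exists (code [:: 2; n]) => t _; apply: S2. Qed.

Lemma cpt_arg C (f : C -> nat) i :
  (forall t, dom t -> onth (env t) i = Some (nat_arg (f t))) -> cpt f.
Proof.
move=> fi; exists (code [:: 8; i]) => t Dt.
exact: (@S8 i [::] [::] _ tt _ _ (fi t Dt) (kleene_args_nil _)).
Qed.

Lemma cpt_head C : @cpt (consN C) (fun t => t.1).
Proof. by apply: (@cpt_arg _ _ 0). Qed.

Lemma cpt_let C (f : C -> nat) (h : consN C -> nat) :
  cpt f -> @cpt (subctx (fun t : consN C => t.1 = f t.2)) h ->
  cpt (fun t => h (f t, t)).
Proof.
move=> [e1 H1] [e0 H0]; exists (code [:: 4; e0; e1]) => t Dt.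
by apply: S4 (H1 t Dt) _; apply: (H0 (f t, t)).
Qed.

Lemma cpt_app C (q : C -> nat -> nat) (n : C -> nat) :
  cpt1 q -> cpt n -> cpt (fun t => q t (n t)).
Proof. by move=> qC nC; apply: cpt_let nC (cpt_restrict _ qC). Qed.

Lemma cpt_succ C (f : C -> nat) : cpt f -> cpt (fun t => (f t).+1).
Proof.
by move=> [e He]; exists (code [:: 4; code [:: 1]; e]) => t Dt;
  apply: S4 (He t Dt) (S1 _ _).
Qed.

Lemma cpt_rec C (f0 n : C -> nat) (h : C -> nat -> nat -> nat) :
  cpt f0 ->
  @cpt (consN (consN C)) (fun t => h t.2.2 t.1 t.2.1) ->
  cpt n -> cpt (fun t => nat_rec (fun=> nat) (f0 t) (h t) (n t)).
Proof.
move=> [e0 H0] [e1 H1] [en Hn].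
exists (code [:: 4; code [:: 5; e0; e1]; en]) => t Dt.
apply: S4 (Hn t Dt) _; elim: (n t) => [|m IH] /=.
  exact/S5_0/H0.
by apply: S5_S IH _; apply: (H1 (m, (_, t))).
Qed.

(** S6 admits only permutations, so the arguments listed in [r] are moved to the front; S9 then
    discards the rest while running the index [m], which S4 supplies as a number. *)
Lemma cpt_rename C C' (h : C' -> C) (r : seq nat) (f : C -> nat) :
  cpt f -> uniq r -> all (fun i => i < len C') r ->
  (forall t, dom t -> dom (h t) /\ env (h t) = pmap (onth (env t)) r) ->
  cpt (fun t => f (h t)).
Proof.
move=> [m Hm] ur /allP rN Hh.
pose p := r ++ [seq i <- iota 0 (len C') | i \notin r].
exists (code [:: 6, code [:: 4; code [:: 9; len C]; code [:: 2; m]] & p]) => t Dt.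
have [Dht Eht] := Hh t Dt.
apply: S6.
  rewrite size_env; apply: uniq_perm; last first.
  - move=> i; rewrite mem_cat mem_filter mem_iota /= add0n.
    by case: (boolP (i \in r)) => //= /rN ->.
  - exact: iota_uniq.
  rewrite cat_uniq ur filter_uniq ?iota_uniq// andbT /=.
  by apply/hasPn => i; rewrite mem_filter => /andP[].
have -> : pmap (onth (env t)) p =
    env (h t) ++ pmap (onth (env t)) [seq i <- iota 0 (len C') | i \notin r].
  by rewrite pmap_cat -Eht.
apply: S4; first exact: S2.
apply: S9; first by rewrite size_cat size_env leq_addr.
by rewrite -(size_env (h t)) take_size_cat//; apply: Hm.
Qed.

Lemma pmap_onth_iota (s : seq arg) : pmap (onth s) (iota 0 (size s)) = s.
Proof.
elim: s => //= a s IH; rewrite -[in RHS]IH -[1]/(1 + 0) iotaDl; congr cons.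
by elim: (iota _ _) => //= i l ->.
Qed.

Lemma pmap_onth_drop (s u : seq arg) (k : nat) : size u = k ->
  pmap (onth (u ++ s)) (iota k (size s)) = s.
Proof.
move=> uk; rewrite -[RHS]pmap_onth_iota -[k in LHS]addn0 iotaDl -uk.
elim: (iota _ _) => //= i l ->; rewrite onth_cat.
by rewrite ltnNge leq_addr /= addnC addnK.
Qed.

Lemma cpt_weak C A (g : A -> arg) (f : C -> nat) :
  cpt f -> @cpt (extend C g) (fun t => f t.2).
Proof.
move=> fC; apply: (@cpt_rename _ _ (fun t : extend C g => t.2)
  (iota 1 (len C))) fC _ _ _.
- exact: iota_uniq.
- by apply/allP => i; rewrite mem_iota add1n => /andP[].
move=> [a t] /= Dt; split=> //.
by rewrite -(size_env t) (@pmap_onth_drop _ [:: g a]).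
Qed.

Lemma cpt_weak2 C A (g : A -> arg) B (h : B -> arg) (f : C -> nat) :
  cpt f -> @cpt (extend (extend C g) h) (fun t => f t.2.2).
Proof.
move=> fC; apply: (@cpt_weak _ _ _ (fun t : extend C g => f t.2)).
exact: cpt_weak.
Qed.

Lemma cpt_head1 C A (g : A -> arg) : @cpt (extend (consN C) g) (fun t => t.2.1).
Proof. by apply: (@cpt_arg _ _ 1). Qed.

Lemma cpt_weak_under C A (g : A -> arg) B (h : B -> arg) (f : B * C -> nat) :
  @cpt (extend C h) f -> @cpt (extend (extend C g) h) (fun t => f (t.1, t.2.2)).
Proof.
set U := extend (extend C g) h => fC.
apply: (@cpt_rename (extend C h) U (fun t : U => (t.1, t.2.2))
  (0 :: iota 2 (len C)) f) fC _ _ _.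
- by rewrite /= mem_iota iota_uniq.
- by apply/allP => i; rewrite inE mem_iota => /orP[/eqP->//|/andP[_]]; rewrite add2n.
move=> [b [a t]] /= Dt; split=> //.
by rewrite -(size_env t) (@pmap_onth_drop _ [:: h b; g a]).
Qed.

Lemma cpt1_weak C A (g : A -> arg) (q : C -> nat -> nat) :
  cpt1 q -> @cpt1 (extend C g) (fun t => q t.2).
Proof. exact: cpt_weak_under. Qed.

Lemma cpt1_cst C (f : C -> nat) : cpt f -> cpt1 (fun t _ => f t).
Proof. exact: cpt_weak. Qed.

Lemma cpt1_var C : @cpt1 (consF C) (fun t => t.1).
Proof.
exists (code [:: 8; 1; code [:: 8; 0]]) => -[n [q t]] /= _.
apply: (@S8 1 [:: _] [:: ty0] (@to_partial [:: ty0] q) (n, tt)) => //.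
apply: kleene_args_cons; last exact: kleene_args_nil.
by case; apply: (@S8 0 [::] [::] _ tt) => //; apply: kleene_args_nil.
Qed.

(** * Arithmetic and propositional connectives *)

Lemma cpt_add C (f g : C -> nat) :
  cpt f -> cpt g -> cpt (fun t => f t + g t).
Proof.
move=> fC gC; apply: (@cpt_ext _
  (fun t => nat_rec (fun=> nat) (g t) (fun _ b => b.+1) (f t))).
  by move=> t _; elim: (f t) => //= n ->; rewrite addSn.
by apply: (@cpt_rec _ _ _ (fun _ _ b => b.+1)) => //; apply: cpt_succ; exact: cpt_head1.
Qed.

Lemma cpt_mul C (f g : C -> nat) :
  cpt f -> cpt g -> cpt (fun t => f t * g t).
Proof.
move=> fC gC; apply: (@cpt_ext _
  (fun t => nat_rec (fun=> nat) 0 (fun _ b => g t + b) (f t))).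
  by move=> t _; elim: (f t) => //= n ->; rewrite mulSn.
apply: (@cpt_rec _ _ _ (fun t _ b => g t + b)) => //; first exact: cpt_const.
by apply: cpt_add; [exact: cpt_weak2|exact: cpt_head1].
Qed.

Lemma cpt_exp2 C (f : C -> nat) : cpt f -> cpt (fun t => 2 ^ f t).
Proof.
move=> fC; apply: (@cpt_ext _
  (fun t => nat_rec (fun=> nat) 1 (fun _ b => 2 * b) (f t))).
  by move=> t _; elim: (f t) => //= n ->; rewrite expnS.
apply: (@cpt_rec _ _ _ (fun t _ b => 2 * b)) => //; first exact: cpt_const.
by apply: cpt_mul; [exact: cpt_const|exact: cpt_head1].
Qed.

Lemma cpt_pred C (f : C -> nat) : cpt f -> cpt (fun t => (f t).-1).
Proof.
move=> fC; apply: (@cpt_ext _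
  (fun t => nat_rec (fun=> nat) 0 (fun n _ => n) (f t))).
  by move=> t _; case: (f t).
apply: (@cpt_rec _ _ _ (fun t n _ => n)) => //; first exact: cpt_const.
exact: cpt_head.
Qed.

Lemma cpt_sub C (f g : C -> nat) :
  cpt f -> cpt g -> cpt (fun t => f t - g t).
Proof.
move=> fC gC; apply: (@cpt_ext _
  (fun t => nat_rec (fun=> nat) (f t) (fun _ b => b.-1) (g t))).
  by move=> t _; elim: (g t) => [|n /= ->] //=; rewrite ?subn0 ?subnS.
by apply: (@cpt_rec _ _ _ (fun t _ b => b.-1)) => //; apply: cpt_pred; exact: cpt_head1.
Qed.

Lemma dcd_eq0 C (f : C -> nat) : cpt f -> dcd (fun t => f t = 0).
Proof.
move=> fC; apply: (@cpt_ext _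
  (fun t => nat_rec (fun=> nat) 0 (fun _ _ => 1) (f t))).
  by move=> t _; case: asboolP; case: (f t).
by apply: (@cpt_rec _ _ _ (fun _ _ _ => 1)) => //; exact: cpt_const.
Qed.

Lemma dcd_leq C (f g : C -> nat) : cpt f -> cpt g -> dcd (fun t => f t <= g t).
Proof.
move=> fC gC; apply: (@dcd_ext _ (fun t => f t - g t = 0)).
  by move=> t _; rewrite -subn_eq0; split => /eqP.
exact/dcd_eq0/cpt_sub.
Qed.

(** With 0 for true, conjunction is addition, negation is subtraction from 1 and disjunction is
    multiplication. *)
Lemma dcd_and C (P Q : C -> Prop) : dcd P -> dcd Q -> dcd (fun t => P t /\ Q t).
Proof.
move=> PC QC; apply: (dcd_ext _ (dcd_eq0 (cpt_add PC QC))) => t _.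
by case: asboolP => Pt; case: asboolP => Qt; split => // -[].
Qed.

Lemma dcd_not C (P : C -> Prop) : dcd P -> dcd (fun t => ~ P t).
Proof.
move=> PC; apply: (dcd_ext _ (dcd_eq0 (cpt_sub (@cpt_const C 1) PC))) => t _.
by case: asboolP => Pt; split => // /(_ Pt).
Qed.

Lemma dcd_or C (P Q : C -> Prop) : dcd P -> dcd Q -> dcd (fun t => P t \/ Q t).
Proof.
move=> PC QC; apply: (dcd_ext _ (dcd_eq0 (cpt_mul PC QC))) => t _.
by case: asboolP => Pt; case: asboolP => Qt; split; auto => -[].
Qed.

Lemma dcd_eqn C (f g : C -> nat) : cpt f -> cpt g -> dcd (fun t => f t = g t).
Proof.
move=> fC gC; apply: (dcd_ext _ (dcd_and (dcd_leq fC gC) (dcd_leq gC fC))) => t _.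
split => [[fg gf]|->]; last by rewrite leqnn.
by apply/eqP; rewrite eqn_leq fg.
Qed.

(* Primitive recursion would evaluate the base case even when [P] fails; the
   index of the branch is computed instead, and then called by S9. *)
Lemma cpt_if C (P : C -> Prop) (f g : C -> nat) :
  dcd P -> @cpt (subctx P) f -> @cpt (subctx (fun t => ~ P t)) g ->
  cpt (fun t => if `[< P t >] then f t else g t).
Proof.
move=> [eP HP] [ef Hf] [eg Hg].
exists (code [:: 4; code [:: 9; len C]; 
  code [:: 4; code [:: 5; code [:: 2; ef]; code [:: 2; eg]]; eP]]).
move=> t Dt; have := HP t Dt.
have S9' m a : kleene m (env t) a -> kleene (code [:: 9; len C]) (nat_arg m :: env t) a.
  by move=> ma; apply: S9; rewrite -(size_env t) ?take_size.
case: asboolP => Pt HPt.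
  by apply/S4/S9'/Hf => //; apply: S4 HPt _; apply/S5_0/S2.
apply/S4/S9'/Hg => //; apply: S4 HPt _; apply: S5_S; last exact: S2.
exact/S5_0/S2.
Qed.

(** * Quantifiers over the natural numbers *)

Section Quantifiers.
Variable C : ctx.

(** [exists2F] is applied to the characteristic function of the predicate, which S8 requires to
    converge at every number. *)
Lemma dcd_ex (P : C -> nat -> Prop) :
  @dcd (consN C) (fun t => P t.2 t.1) -> dcd (fun t => exists n, P t n).
Proof.
move=> [e He]; have [i Hi] := has_exists2 C; exists (code [:: 8; i; e]) => t Dt.
pose x n := if `[< P t n >] then 0 else 1.
have -> : (if `[< exists n, P t n >] then 0 else 1) = exists2F x.
  congr (if _ then _ else _); apply: asbool_equiv_eq.
  by split => -[n Hn]; exists n; move: Hn; rewrite /x; case: asboolP.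
apply: (@S8 i _ [:: ty1] (@to_partial [:: ty1] exists2F) (x, tt)) => //.
apply: kleene_args_cons; last exact: kleene_args_nil.
by move=> [n []]; apply: (He (n, t)).
Qed.

Lemma dcd_all (P : C -> nat -> Prop) :
  @dcd (consN C) (fun t => P t.2 t.1) -> dcd (fun t => forall n, P t n).
Proof.
move=> PC; apply: (dcd_ext _ (dcd_not (dcd_ex (P := fun t n => ~ P t n) _))).
  by move=> t _; split => [/forallNP H n|H [n]//]; apply: contrapT.
exact: dcd_not.
Qed.

End Quantifiers.

(** * Recursion along well-founded relations, and unbounded search *)

Section Recursion.
Variables (C : ctx) (A : Type) (g : A -> arg) (D : A * C -> Prop).
Variables (lt : C -> A -> A -> Prop) (f : A * C -> nat).

(** The context for the body of a recursion: besides the current argument it carries a number that,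
    run on itself, computes [f] at every smaller argument in [D]. *)
Definition rec_ctx : ctx :=
  @subctx (extend (@subctx (extend C g) D) nat_arg)
    (fun x => forall a, D (a, x.2.2) -> lt x.2.2 a x.2.1 ->
       kleene x.1 (nat_arg x.1 :: g a :: env x.2.2) (f (a, x.2.2))).

(* The self-referential index is passed to itself as a number argument, which
   replaces the recursion theorem. *)
Lemma cpt_fix : @cpt rec_ctx (fun x => f x.2) ->
  (forall a t, dom t -> D (a, t) -> Acc (fun a b => D (a, t) /\ lt t a b) a) ->
  @cpt (@subctx (extend C g) D) f.
Proof.
move=> [b Hb] Hacc; exists (code [:: 4; b; code [:: 2; b]]) => -[a t] [/= Dt Dat].
apply: S4 (S2 _ _) _.
have acc_a := Hacc a t Dt Dat.
elim: {a}acc_a Dat => a _ IH Dat.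
by apply: (Hb (b, (a, t))); split=> //= a' Da' lt_a'; apply: IH.
Qed.

(* The recursive call, at any argument [x.1] bound after the current one. *)
Lemma cpt_self : @cpt (@subctx (extend rec_ctx g)
    (fun x => D (x.1, x.2.2.2) /\ lt x.2.2.2 x.1 x.2.2.1))
  (fun x => f (x.1, x.2.2.2)).
Proof.
pose S := @subctx (extend (extend C g) nat_arg)
  (fun x => kleene x.1 (nat_arg x.1 :: g x.2.1 :: env x.2.2) (f x.2)).
have SC : @cpt S (fun x => f x.2).
  (* S4 puts a second copy of the head number in front; S9 then runs one copy as an index with the
     other as its argument. *)
  exists (code [:: 4; code [:: 9; (len C).+2]; code [:: 8; 0]]).
  move=> [m [a t]] [/= Dt Hm].
  apply: S4; first by apply: (@S8 0 [::] [::] (Some m) tt) => //;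
    apply: kleene_args_nil.
  by apply: S9; rewrite /= -(size_env t) ?take_size.
set U := subctx _.
(* The argument of the caller, at position 2, is dropped; the stored number and the new argument are
   exchanged. *)
apply: (@cpt_rename S U (fun x : U => (x.2.1, (x.1, x.2.2.2)))
  [:: 1, 0 & iota 3 (len C)] (fun x => f x.2)) SC _ _ _.
- by rewrite /= !inE !mem_iota iota_uniq.
- apply/allP => i; rewrite !inE mem_iota => /or3P[/eqP->//|/eqP->//|/andP[_]].
  by rewrite add3n.
move=> [a [m [b t]]] [[[/= Dt _] Hm] [Dat lta]]; split; first by split=> //; apply: Hm.
by rewrite -(size_env t) (@pmap_onth_drop _ [:: g a; nat_arg m; g b]).
Qed.

End Recursion.

(** The schemes contain no minimization: the search is a recursion from [n] to [n.+1], well founded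
    on the numbers up to the solution [f t]. *)
Lemma cpt_mu (C : ctx) (P : C -> nat -> Prop) (f : C -> nat) :
  @dcd (consN C) (fun t => P t.2 t.1) ->
  (forall t, dom t -> P t (f t) /\ forall n, P t n -> f t <= n) -> cpt f.
Proof.
move=> PC fP; pose D (x : nat * C) := x.1 <= f x.2.
pose lt (t : C) (a b : nat) := b < a.
suff : @cpt (@subctx (consN C) D) (fun x => f x.2).
  move=> H; apply: (@cpt_let C (fun=> 0) (fun x => f x.2)); first exact: cpt_const.
  case: H => e He; exists e => -[n t] [/= Dt n0]; apply: (He (n, t)).
  by split=> //; rewrite /D n0.
apply: (@cpt_fix C nat nat_arg D lt) => /=; last first.
  move=> a t Dt; rewrite /D /lt /=.
  have [k] := ubnP (f t - a); elim: k a => [|k IH] a; first by rewrite ltn0.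
  rewrite ltnS => lek Da.
  constructor => b [Db ab]; apply: IH => //; apply: leq_trans lek.
  by apply: ltn_sub2l => //; apply: leq_trans Db.
set RC := @rec_ctx C nat nat_arg D lt (fun x => f x.2).
apply: (@cpt_ext RC (fun x : RC => if `[< P x.2.2 x.2.1 >] then x.2.1 else f x.2.2)).
  move=> [m [n t]] [[/= Dt Dn] _]; case: asboolP => // Pn.
  by apply/eqP; rewrite eqn_leq [X in X && _]Dn (fP t Dt).2.
apply: cpt_if.
- apply: cpt_restrict; apply: (@cpt_weak (@subctx (consN C) D) _ nat_arg
    (fun x => if `[< P x.2 x.1 >] then 0 else 1)).
  exact: cpt_restrict PC.
- do 2!apply: cpt_restrict; apply: (@cpt_weak (@subctx (consN C) D) _ nat_arg fst).
  by apply: cpt_restrict; exact: cpt_head.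
set R := subctx _.
apply: (@cpt_let R (fun x => x.2.1.+1) (fun x => f x.2.2.2)).
  apply: cpt_succ; do 2!apply: cpt_restrict.
  apply: (@cpt_weak (@subctx (consN C) D) _ nat_arg fst).
  by apply: cpt_restrict; exact: cpt_head.
have [e He] := @cpt_self C nat nat_arg D lt (fun x => f x.2).
exists e => -[n' [m [n t]]] [[[/= Dt HD] HP] n'E]; apply: (He (n', (m, (n, t)))).
split=> //=; rewrite n'E; split; last exact: ltnSn.
move: Dt => [Dt Dn]; rewrite /D /= ltn_neqAle [X in _ && X]Dn andbT.
by apply/eqP => nE; apply: HP; rewrite /= nE; apply: (fP t Dt).1.
Qed.

(** * Codes and names *)

Lemma code_nil : code [::] = 0. Proof. by []. Qed.

Lemma code_cons n s : code (n :: s) = 2 ^ n * (2 * code s + 1).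
Proof. by rewrite addn1 mul2n. Qed.

Definition hd (k : nat) : nat := nth 0 (decode k) 0.
Definition tl (k : nat) : nat := code (behead (decode k)).

Lemma hd_code n s : hd (code (n :: s)) = n.
Proof. by rewrite /hd CodeSeq.codeK. Qed.

Lemma tl_code n s : tl (code (n :: s)) = code s.
Proof. by rewrite /tl CodeSeq.codeK. Qed.

Lemma code_hd_tl k : k != 0 -> k = 2 ^ hd k * (2 * tl k + 1).
Proof.
rewrite -[k in k != 0]CodeSeq.decodeK -[LHS]CodeSeq.decodeK /hd /tl.
by case: (decode k) => // n s _; rewrite code_cons.
Qed.

Lemma exp2_odd_inj k n m : k = 2 ^ n * (2 * m + 1) -> n = hd k /\ m = tl k.
Proof.
rewrite -[m in 2 * m]CodeSeq.decodeK -code_cons => ->.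
by rewrite hd_code tl_code CodeSeq.decodeK.
Qed.

Lemma cpt_cons C (f : C -> nat) (s : C -> seq nat) :
  cpt f -> cpt (fun t => code (s t)) -> cpt (fun t => code (f t :: s t)).
Proof.
move=> fC sC; apply: (@cpt_ext _ (fun t => 2 ^ f t * (2 * code (s t) + 1))).
  by move=> t _; rewrite code_cons.
apply: cpt_mul; first exact: cpt_exp2.
by apply: cpt_add (cpt_const _ _); apply: cpt_mul => //; exact: cpt_const.
Qed.

Lemma cpt_code2 C (f g : C -> nat) :
  cpt f -> cpt g -> cpt (fun t => code [:: f t; g t]).
Proof. by move=> fC gC; do 2 apply: cpt_cons => //; apply: cpt_const. Qed.

Lemma cpt_code3 C (f g h : C -> nat) :
  cpt f -> cpt g -> cpt h -> cpt (fun t => code [:: f t; g t; h t]).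
Proof. by move=> fC gC hC; do 3 apply: cpt_cons => //; apply: cpt_const. Qed.

(** A nonzero code is [2 ^ n * (2 * m + 1)] for unique [n] and [m], which are found by search; the
    disjunct for the code 0 makes the search stop at the default value 0. *)
Lemma cpt_hd C (f : C -> nat) : cpt f -> cpt (fun t => hd (f t)).
Proof.
move=> fC; pose P t n := f t = 0 \/ exists m, f t = 2 ^ n * (2 * m + 1).
apply: (@cpt_mu C P) => [|t _].
  apply: dcd_or; first exact/dcd_eqn/cpt_const/cpt_weak.
  apply: (@dcd_ex (consN C) (fun t m => f t.2 = 2 ^ t.1 * (2 * m + 1))).
  apply: dcd_eqn; first exact: cpt_weak2.
  apply: cpt_mul; first by apply: cpt_exp2; exact: cpt_head1.
  apply: cpt_add (cpt_const _ _).
  by apply: cpt_mul; [exact: cpt_const|exact: cpt_head].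
have [f0|f0] := eqVneq (f t) 0; first by rewrite f0; split=> [|n _]; [left|].
split; first by right; exists (tl (f t)); exact: code_hd_tl.
move=> n [/eqP|[m /exp2_odd_inj[->//]]].
by rewrite (negPf f0).
Qed.

Lemma cpt_tl C (f : C -> nat) : cpt f -> cpt (fun t => tl (f t)).
Proof.
move=> fC; pose P t m := f t = 0 \/ exists n, f t = 2 ^ n * (2 * m + 1).
apply: (@cpt_mu C P) => [|t _].
  apply: dcd_or; first exact/dcd_eqn/cpt_const/cpt_weak.
  apply: (@dcd_ex (consN C) (fun t n => f t.2 = 2 ^ n * (2 * t.1 + 1))).
  apply: dcd_eqn; first exact: cpt_weak2.
  apply: cpt_mul; first by apply: cpt_exp2; exact: cpt_head.
  apply: cpt_add (cpt_const _ _).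
  by apply: cpt_mul; [exact: cpt_const|exact: cpt_head1].
have [f0|f0] := eqVneq (f t) 0; first by rewrite f0; split=> [|n _]; [left|].
split; first by right; exists (hd (f t)); exact: code_hd_tl.
move=> n [/eqP|[m /exp2_odd_inj[_ ->//]]].
by rewrite (negPf f0).
Qed.

(** The inequality [a + e / 2 ^ n <= b] between coded rationals, with denominators cleared and
    negative terms moved across, so that only natural numbers occur. *)
Definition rat_le_add (a b e n : nat) : bool :=
  hd a * (hd (tl (tl b))).+1 * 2 ^ n + hd (tl b) * (hd (tl (tl a))).+1 * 2 ^ n
    + e * ((hd (tl (tl a))).+1 * (hd (tl (tl b))).+1) <=
  hd b * (hd (tl (tl a))).+1 * 2 ^ n + hd (tl a) * (hd (tl (tl b))).+1 * 2 ^ n.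

Lemma dec_ratE k :
  dec_rat k = (((hd k)%:R - (hd (tl k))%:R) / (hd (tl (tl k))).+1%:R)%R.
Proof. by rewrite /dec_rat /hd /tl !CodeSeq.codeK !nth_behead. Qed.

Lemma rat_le_addE a b e n :
  rat_le_add a b e n = (dec_rat a + e%:R / 2 ^+ n <= dec_rat b)%R.
Proof.
rewrite /rat_le_add !dec_ratE.
set a1 := hd a; set a2 := hd (tl a); set a3 := hd (tl (tl a)).
set b1 := hd b; set b2 := hd (tl b); set b3 := hd (tl (tl b)).
rewrite -(ler_nat rat) !(natrD, natrM, natrX).
have ha : (0 < a3.+1%:R :> rat)%R by rewrite ltr0n.
have hb : (0 < b3.+1%:R :> rat)%R by rewrite ltr0n.
have hn : (0 < 2 ^+ n :> rat)%R by rewrite exprn_gt0.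
move: ha hb hn; move: (a3.+1%:R)%R (b3.+1%:R)%R (2 ^+ n)%R => A B N A0 B0 N0.
rewrite -subr_ge0 -[RHS]subr_ge0.
set L := (L in (0 <= L)%R = _); set L' := (L' in _ = (0 <= L')%R).
have -> : (L' = L / (A * B * N))%R.
  by rewrite /L /L'; field; rewrite !gt_eqF.
by rewrite pmulr_lge0// invr_gt0 !mulr_gt0.
Qed.

(* The terms of two names are off by at most [2 ^- n] each, so that a difference
   of [3 * 2 ^- n] implies a strict inequality of the reals. *)
Definition name_lt (p q : nat -> nat) : Prop :=
  exists n, rat_le_add (p n) (q n) 3 n.

Definition cauchy_name (q : nat -> nat) : Prop :=
  forall n i, ~ rat_le_add (q n) (q (n + i)) 1 n /\
              ~ rat_le_add (q (n + i)) (q n) 1 n.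

Definition name01 (q : nat -> nat) : Prop :=
  ~ name_lt q (fun=> 0) /\ ~ name_lt (fun=> code [:: 1]) q.

Definition separates (r : nat) (p q : nat -> nat) : Prop :=
  name_lt p (fun=> r) /\ name_lt (fun=> r) q \/
  name_lt q (fun=> r) /\ name_lt (fun=> r) p.

Definition name_neq (p q : nat -> nat) : Prop := name_lt p q \/ name_lt q p.

Lemma dcd_rat_le_add C (a b e n : C -> nat) :
  cpt a -> cpt b -> cpt e -> cpt n ->
  dcd (fun t => rat_le_add (a t) (b t) (e t) (n t)).
Proof.
move=> aC bC eC nC.
have [a1 a2 a3] : [/\ cpt (fun t => hd (a t)), cpt (fun t => hd (tl (a t)))
    & cpt (fun t => (hd (tl (tl (a t)))).+1)].
  by split; [|apply: cpt_hd|apply: cpt_succ; apply: cpt_hd; apply: cpt_tl];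
    [apply: cpt_hd|apply: cpt_tl|apply: cpt_tl].
have [b1 b2 b3] : [/\ cpt (fun t => hd (b t)), cpt (fun t => hd (tl (b t)))
    & cpt (fun t => (hd (tl (tl (b t)))).+1)].
  by split; [|apply: cpt_hd|apply: cpt_succ; apply: cpt_hd; apply: cpt_tl];
    [apply: cpt_hd|apply: cpt_tl|apply: cpt_tl].
have n2 := cpt_exp2 nC.
by apply: dcd_leq; do ?[apply: cpt_add|apply: cpt_mul].
Qed.

Lemma dcd_name_lt C (p q : C -> nat -> nat) :
  cpt1 p -> cpt1 q -> dcd (fun t => name_lt (p t) (q t)).
Proof.
move=> pC qC; apply: (@dcd_ex C (fun t n => rat_le_add (p t n) (q t n) 3 n)).
by apply: dcd_rat_le_add => //; [exact: cpt_const|exact: cpt_head].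
Qed.

Lemma dcd_cauchy_name C (q : C -> nat -> nat) :
  cpt1 q -> dcd (fun t => cauchy_name (q t)).
Proof.
move=> qC; apply: (@dcd_all C (fun t n => forall i,
   ~ rat_le_add (q t n) (q t (n + i)) 1 n /\
   ~ rat_le_add (q t (n + i)) (q t n) 1 n)).
have q2 := cpt1_weak nat_arg (cpt1_weak nat_arg qC).
apply: (@dcd_all (consN C) (fun t i =>
   ~ rat_le_add (q t.2 t.1) (q t.2 (t.1 + i)) 1 t.1 /\
   ~ rat_le_add (q t.2 (t.1 + i)) (q t.2 t.1) 1 t.1)).
have qn : @cpt (consN (consN C)) (fun t => q t.2.2 t.2.1).
  by apply: (cpt_app q2); exact: cpt_head1.
have qni : @cpt (consN (consN C)) (fun t => q t.2.2 (t.2.1 + t.1)).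
  by apply: (cpt_app q2); apply: cpt_add; [exact: cpt_head1|exact: cpt_head].
have n1 := @cpt_head1 C nat nat_arg.
by apply: dcd_and; apply: dcd_not; apply: dcd_rat_le_add => //; exact: cpt_const.
Qed.

Lemma dcd_name01 C (q : C -> nat -> nat) : cpt1 q -> dcd (fun t => name01 (q t)).
Proof.
move=> qC; apply: dcd_and; apply: dcd_not; apply: dcd_name_lt => //;
  exact: cpt_const.
Qed.

Lemma dcd_separates C (r : C -> nat) (p q : C -> nat -> nat) :
  cpt r -> cpt1 p -> cpt1 q -> dcd (fun t => separates (r t) (p t) (q t)).
Proof.
move=> /cpt1_cst rC pC qC.
by apply: dcd_or; apply: dcd_and; apply: dcd_name_lt.
Qed.

Lemma dcd_name_neq C (p q : C -> nat -> nat) :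
  cpt1 p -> cpt1 q -> dcd (fun t => name_neq (p t) (q t)).
Proof. by move=> pC qC; apply: dcd_or; apply: dcd_name_lt. Qed.

(** The third entry is [2 ^ n] minus 1 because [dec_rat] adds 1 to the denominator. *)
Definition dyadic (j n : nat) : nat := code [:: j; 0; (2 ^ n).-1].

Lemma dec_dyadic j n : dec_rat (dyadic j n) = (j%:R / 2 ^+ n)%R.
Proof.
rewrite dec_ratE /dyadic !(hd_code, tl_code) subr0 prednK ?expn_gt0//.
by rewrite natrX.
Qed.

Lemma dec_code1 n : dec_rat (code [:: n]) = n%:R%R.
Proof.
rewrite dec_ratE !(hd_code, tl_code).
by rewrite /hd -[0]code_nil CodeSeq.codeK /= subr0 divr1.
Qed.

Lemma dec_rat0 : dec_rat 0 = 0%R.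
Proof. by rewrite -code_nil /dec_rat CodeSeq.codeK /= subrr mul0r. Qed.

Local Open Scope classical_set_scope.
Local Open Scope ring_scope.

(** * Meaning of the relations between names for the named reals *)

Section RealNames.
Variable R : realType.
Implicit Types (p q : nat -> nat) (x y : R).

Lemma exists_exp2_lt (e : R) : 0 < e -> exists n, (2%:R ^+ n)^-1 < e.
Proof.
move=> e0; exists (Num.trunc e^-1).+1.
rewrite invf_plt ?posrE ?exprn_gt0//.
apply: lt_le_trans (truncnS_gt _) _.
by rewrite -natrX ler_nat ltnW// ltn_expl.
Qed.

Lemma ratr_frac (j n : nat) : ratr (j%:R / 2%:R ^+ n) = j%:R / 2%:R ^+ n :> R.
Proof. by rewrite fmorph_div rmorphXn /= !ratr_nat. Qed.

Lemma ratr_exp2 (n : nat) : ratr (2%:R ^- n) = (2%:R ^+ n)^-1 :> R.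
Proof. by rewrite fmorphV rmorphXn /= ratr_nat. Qed.

Lemma names_dist q x n : names_real q x ->
  `|ratr (dec_rat (q n)) - x| <= (2%:R ^+ n)^-1.
Proof.
move=> [qC /cvgrPdist_lt qx]; apply/ler_addgt0Pr => e e0.
have [N _ HN] := qx e e0.
have := HN (n + N)%N (leq_addl _ _) => /= dN.
have dn : `|ratr (dec_rat (q n)) - ratr (dec_rat (q (n + N)%N))| < (2%:R ^+ n)^-1 :> R.
  rewrite -rmorphB /= -ratr_norm.
  by rewrite -ratr_exp2 ltr_rat.
rewrite -[X in `|X|](subrKA (ratr (dec_rat (q (n + N)%N)))).
apply: le_trans (ler_normD _ _) _; apply: lerD; first exact: ltW.
by rewrite distrC ltW.
Qed.

Lemma cauchy_names q x : names_real q x -> cauchy_name q.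
Proof.
move=> [qC _] n i; move: (qC n i); rewrite !rat_le_addE mul1r ltr_norml => /andP[l r].
by split; apply/negP; rewrite -ltNge; lra.
Qed.

Lemma cauchy_nameP q : cauchy_name q -> exists x, names_real q x.
Proof.
move=> qC.
have q1 n i : `|dec_rat (q n) - dec_rat (q (n + i)%N)| < 2%:R ^- n.
  have [/negP + /negP] := qC n i; rewrite !rat_le_addE mul1r -!ltNge => l r.
  by rewrite ltr_norml; apply/andP; split; lra.
suff /cvg_ex[x qx] : cvg ((ratr (dec_rat (q n)) : R) @[n --> \oo]) by exists x.
apply/cauchy_cvgP/cauchyP => e e0.
have [n ne] := exists_exp2_lt e0.
exists (ratr (dec_rat (q n))); exists n => // m /= nm.
rewrite -ball_normE /= -rmorphB /= -ratr_norm; apply: lt_trans ne.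
by rewrite -ratr_exp2 ltr_rat -(subnKC nm).
Qed.

Lemma name_ltP p q x y : names_real p x -> names_real q y -> name_lt p q <-> x < y.
Proof.
move=> px qy; split.
  move=> [n]; rewrite rat_le_addE -(ler_rat R) rmorphD /= ratr_frac.
  have := names_dist n px; have := names_dist n qy.
  have : 0 < (2%:R ^+ n)^-1 :> R by rewrite invr_gt0 exprn_gt0.
  by rewrite !ler_norml; lra.
(* With [2 ^- n] below a fifth of [y - x], the errors of the two terms still leave a gap of three
   times [2 ^- n]. *)
move=> xy; have [|n ne] := @exists_exp2_lt ((y - x) / 5%:R); first by lra.
exists n; rewrite rat_le_addE -(ler_rat R) rmorphD /= ratr_frac.
have := names_dist n px; have := names_dist n qy.
by rewrite !ler_norml; lra.
Qed.

Lemma names_cst k : names_real (fun=> k) (ratr (dec_rat k) : R).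
Proof.
by split; [move=> n i; rewrite subrr normr0 invr_gt0 exprn_gt0|exact: cvg_cst].
Qed.

Lemma names_zero : names_real (fun=> 0%N) (0 : R).
Proof. by have := names_cst 0; rewrite dec_rat0 rmorph0. Qed.

Lemma names_one : names_real (fun=> code [:: 1%N]) (1 : R).
Proof. by have := names_cst (code [:: 1%N]); rewrite dec_code1 rmorph1. Qed.

Lemma name01P q x : names_real q x -> name01 q <-> 0 <= x <= 1.
Proof.
move=> qx; rewrite /name01 (name_ltP qx names_zero) (name_ltP names_one qx).
split => [[/negP+ /negP]|/andP[x0 x1]].
  by rewrite -!leNgt => ? ?; apply/andP.
by split; apply/negP; rewrite -leNgt.
Qed.

Lemma name_neqP p q x y : names_real p x -> names_real q y ->
  name_neq p q <-> x <> y.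
Proof.
move=> px qy; rewrite /name_neq (name_ltP px qy) (name_ltP qy px).
split => [[xy|yx] E|/eqP]; first by rewrite E ltxx in xy.
  by rewrite E ltxx in yx.
by rewrite neq_lt => /orP.
Qed.

Definition separates_real (r : R) x y := x < r < y \/ y < r < x.

Lemma separatesP r p q x y : names_real p x -> names_real q y ->
  separates r p q <-> separates_real (ratr (dec_rat r)) x y.
Proof.
move=> px qy; have rr := names_cst r.
rewrite /separates (name_ltP px rr) (name_ltP rr qy) (name_ltP qy rr) (name_ltP rr px).
by rewrite /separates_real; split => [[[a b]|[a b]]|[/andP[a b]|/andP[a b]]];
  [left; apply/andP|right; apply/andP|left|right].
Qed.

Definition digit x (n j : nat) := j%:R / 2%:R ^+ n <= x < j.+1%:R / 2%:R ^+ n.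

(** The approximation at stage [n] exceeds [x - 2 ^- n] and is at most [x], so any two from stage
    [n] on differ by less than [2 ^- n]. *)
Lemma names_digits x (j : nat -> nat) : (forall n, digit x n (j n)) ->
  names_real (fun n => dyadic (j n) n) x.
Proof.
move=> jx.
have bnd n : x - (2%:R ^+ n)^-1 < ratr (dec_rat (dyadic (j n) n)) <= x.
  have /andP[j1 j2] := jx n.
  rewrite dec_dyadic ratr_frac j1 andbT.
  by move: j2; rewrite -natr1 mulrDl mul1r; lra.
have le2 n i : (2%:R ^+ (n + i))^-1 <= (2%:R ^+ n)^-1 :> R.
  by rewrite lef_pV2 ?posrE ?exprn_gt0// -!natrX ler_nat leq_exp2l// leq_addr.
split.
  move=> n i; rewrite -(ltr_rat R) ratr_norm rmorphB /= ratr_exp2.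
  have := bnd n; have := bnd (n + i)%N; have := le2 n i.
  by rewrite ltr_norml; lra.
apply/cvgrPdist_lt => e e0; have [n ne] := exists_exp2_lt e0.
exists n => // m /= nm; have := bnd m; have := le2 n (m - n)%N; rewrite subnKC//.
by rewrite ltr_norml; lra.
Qed.

Lemma digit_exists x n : 0 <= x -> exists j, digit x n j.
Proof.
move=> x0; exists (Num.trunc (x * 2%:R ^+ n)).
have n0 : 0 < 2%:R ^+ n :> R by rewrite exprn_gt0.
rewrite /digit ler_pdivrMr// ltr_pdivlMr// truncnS_gt andbT.
by rewrite truncn_le// mulr_ge0// ltW.
Qed.

Lemma name_exists x : 0 <= x -> exists q, names_real q x.
Proof.
move=> x0; have /choice[j jx] : forall n, exists j, digit x n j.
  by move=> n; exact: digit_exists.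
by exists (fun n => dyadic (j n) n); exact: names_digits.
Qed.

End RealNames.

(** * Jumps of a function of bounded variation *)

(** The counterpart of [jumps] on names; all quantifiers involved range over numbers. *)
Definition in_jumps (F : (nat -> nat) -> nat -> nat) (r : nat)
    (q : nat -> nat) : Prop :=
  [/\ cauchy_name q, name01 q & separates r (F (fun=> 0%N)) (F q)].

(** The quantifier ranges over sequences, so a search by [exists2F] does not apply directly;
    [dcd_below] decides it by recursion and Omega. *)
Definition below (F : (nat -> nat) -> nat -> nat) (r : nat) (q : nat -> nat) : Prop :=
  exists q', in_jumps F r q' /\ name_lt q' q.

Definition rat_jump (F : (nat -> nat) -> nat -> nat) (r : nat) : Prop :=
  name01 (fun=> r) /\ name_neq (F (fun=> 0%N)) (F (fun=> r)).

Section Jumps.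
Variable R : realType.
Implicit Types (f : R -> R) (x y : R) (F : (nat -> nat) -> nat -> nat) (q : nat -> nat).

Definition jumps f (r : nat) : set R :=
  [set x | 0 <= x <= 1 /\ separates_real (ratr (dec_rat r)) (f 0) (f x)].

Definition rat_constant f := forall s : rat, 0 <= (ratr s : R) <= 1 -> f (ratr s) = f 0.

Lemma in_jumpsP F f r q x : names_fun01 F f -> names_real q x ->
  in_jumps F r q <-> jumps f r x.
Proof.
move=> Ff qx; have F0 : names_real (F (fun=> 0%N)) (f 0).
  by apply: Ff; [rewrite lexx ler01|exact: names_zero].
split=> [[_ /(name01P qx) x01]|[x01]].
  by move=> /(separatesP r F0 (Ff _ _ x01 qx)).
move=> /(separatesP r F0 (Ff _ _ x01 qx)) sx.
by split=> //; [exact: cauchy_names qx|exact/(name01P qx)].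
Qed.

Lemma belowP F f r q x : names_fun01 F f -> names_real q x ->
  below F r q <-> exists y, jumps f r y /\ y < x.
Proof.
move=> Ff qx; split => [[q' [Xq' lt_q']]|[y [Xy yx]]].
  have [y q'y] : exists y : R, names_real q' y by case: Xq' => /(cauchy_nameP R).
  exists y; split; first exact/(in_jumpsP r Ff q'y).
  exact/(name_ltP q'y qx).
have [q' q'y] : exists q', names_real q' y.
  by case: (Xy) => /andP[y0 _] _; exact: name_exists.
exists q'; split; first exact/(in_jumpsP r Ff q'y).
exact/(name_ltP q'y qx).
Qed.

(* A rational between two jumps forces the total variation to grow by more
   than the distance from [f 0] to the separating rational. *)
Lemma jumps_measure f r : bounded_variation 0 1 f -> rat_constant f ->
  exists mu : R -> nat, forall x y,
    jumps f r x -> jumps f r y -> x < y -> (mu x < mu y)%N.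
Proof.
move=> bvf fc; pose V x := fine (total_variation 0 x f).
pose d := `|ratr (dec_rat r) - f 0|.
(* The witness counts the variation on [0, x] in units of [d]; an increase by at least [d] raises
   the integer part. *)
exists (fun x => Num.trunc (V x / d)) => x y [/andP[x0 x1] Xx] [/andP[y0 y1] _] xy.
have d0 : 0 < d.
  by rewrite normr_gt0 subr_eq0; case: Xx => /andP[a b];
    [rewrite gt_eqF|rewrite lt_eqF].
have dx : d <= `|f 0 - f x|.
  rewrite /d; case: Xx => /andP[a b].
    by rewrite gtr0_norm ?subr_gt0// ltr0_norm ?subr_lt0 ?(lt_trans a b)//; lra.
  by rewrite ltr0_norm ?subr_lt0// gtr0_norm ?subr_gt0 ?(lt_trans a b)//; lra.
have [s] := rat_in_itvoo xy; rewrite in_itv /= => /andP[xs sy].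
have fs : f (ratr s) = f 0 by apply: fc; apply/andP; split; lra.
have fin a b : 0 <= a -> a <= b -> b <= 1 -> total_variation a b f \is a fin_num.
  move=> a0 ab b1; apply/bounded_variationP => //.
  have b0 := le_trans a0 ab.
  exact: (bounded_variationr a0 ab (bounded_variationl b0 b1 bvf)).
have Vxy : V x + d <= V y.
  have xy' := ltW xy.
  rewrite /V (total_variationD f x0 xy') fineD ?fin// lerD2l.
  apply: le_trans dx _; rewrite -lee_fin fineK ?fin//.
  rewrite (total_variationD f (ltW xs) (ltW sy)) -fs.
  apply: le_trans (total_variation_ge f (ltW xs)) _.
  by rewrite leeDl// total_variation_ge0// ltW.
have V0 : 0 <= V x by rewrite fine_ge0// total_variation_ge0.
have : V x / d + 1 <= V y / d.
  by rewrite -[1](divff (lt0r_neq0 d0)) -mulrDl ler_pM2r ?invr_gt0.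
move=> H; rewrite truncn_gt_nat -natr1; apply: le_trans H; rewrite lerD2r.
by rewrite truncn_le divr_ge0// ltW.
Qed.

(** Passing to a smaller jump lowers the natural number given by [jumps_measure], so a descent from
    [x] must stop. *)
Lemma jumps_least f r x : bounded_variation 0 1 f -> rat_constant f ->
  jumps f r x ->
  exists y, [/\ jumps f r y, y <= x & ~ exists z, jumps f r z /\ z < y].
Proof.
move=> bvf /(jumps_measure r bvf)[mu Hmu].
have [k] := ubnP (mu x); elim: k x => [|k IH] x; first by rewrite ltn0.
rewrite ltnS => muk Xx; case: (pselect (exists z, jumps f r z /\ z < x)); last first.
  by exists x.
move=> [z [Xz zx]]; have [|y [Xy yz Ny]] := IH z _ Xz.
  exact: leq_trans (Hmu _ _ Xz Xx zx) muk.
by exists y; split=> //; apply: le_trans yz (ltW zx).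
Qed.

(** The termination argument for [cpt_fix]; the induction is on the measure of the named real, as
    one real has many names. *)
Lemma in_jumps_acc F f r q : names_fun01 F f -> bounded_variation 0 1 f ->
  rat_constant f -> in_jumps F r q ->
  Acc (fun a b => in_jumps F r a /\ name_lt a b) q.
Proof.
move=> Ff bvf /(jumps_measure r bvf)[mu Hmu].
suff : forall k x, jumps f r x -> (mu x < k)%N -> forall q, names_real q x ->
    Acc (fun a b => in_jumps F r a /\ name_lt a b) q.
  move=> H Xq; have [x qx] : exists x : R, names_real q x.
    by case: Xq => /(cauchy_nameP R).
  exact: (H (mu x).+1 x (proj1 (in_jumpsP r Ff qx) Xq) (ltnSn _) q qx).
elim => [|k IH] x Xx; first by rewrite ltn0.
rewrite ltnS => muk {}q qx; constructor => a [Xa aq].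
have [y ay] : exists y : R, names_real a y by case: Xa => /(cauchy_nameP R).
have Xy := proj1 (in_jumpsP r Ff ay) Xa.
apply: (IH y) => //; apply: leq_trans muk; apply: Hmu => //.
exact/(name_ltP ay qx).
Qed.

End Jumps.

(** * Deciding with Omega whether a jump lies below a given real *)

Section Programs.
Variable R : realType.
Variable Om : partial set_to_seq.
Hypothesis OmP : is_Omega R Om.

Definition has_Omega (C : ctx) :=
  exists i, forall t : C, onth (env t) i = Some (Arg Om).

Definition has_fun (C : ctx) (F : C -> (nat -> nat) -> nat -> nat) :=
  exists i, forall t : C,
    onth (env t) i = Some (@total_arg (Ar [:: ty1; ty0]) (F t)).

Lemma has_fun_extend C A (g : A -> arg) (F : C -> (nat -> nat) -> nat -> nat) :
  @has_fun C F -> @has_fun (extend C g) (fun t => F t.2).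
Proof. by move=> [i Hi]; exists i.+1 => -[a t]; exact: Hi. Qed.

Lemma has_Omega_extend C A (g : A -> arg) : has_Omega C -> has_Omega (extend C g).
Proof. by move=> [i Hi]; exists i.+1 => -[a t]; exact: Hi. Qed.

Lemma cpt1_fun C (F : C -> (nat -> nat) -> nat -> nat) (q : C -> nat -> nat) :
  has_fun F -> cpt1 q -> cpt1 (fun t => F t (q t)).
Proof.
move=> /(has_fun_extend nat_arg)[i Hi] /(cpt1_weak nat_arg)[d Hd].
have [v Hv] := @cpt_head C; exists (code [:: 8; i; d; v]) => -[n t] /= Dt.
apply: (@S8 i [:: d; v] [:: ty1; ty0] _ (q t, (n, tt))); [exact: (Hi (n, t))| |by []].
apply: kleene_args_cons; first by move=> [m []]; apply: (Hd (m, (n, t))).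
by apply: kleene_args_cons (kleene_args_nil _); case; apply: (Hv (n, t)).
Qed.

(** Since S8 needs total arguments, [G] has to be computed at every sequence, including those that
    name no real. *)
Lemma cpt1_Omega C (G : C -> (nat -> nat) -> nat) (g : C -> nat -> nat) :
  has_Omega C -> @cpt (consF C) (fun x => G x.2 x.1) ->
  (forall t, dom t -> forall n, Om (G t) n = Some (g t n)) -> cpt1 g.
Proof.
move=> /(has_Omega_extend nat_arg)[i Hi] GC GE.
have [d Hd] := @cpt_weak_under C nat nat_arg _ _ (fun x => G x.2 x.1) GC.
have [v Hv] := @cpt_head C; exists (code [:: 8; i; d; v]) => -[n t] /= Dt.
apply: (@S8 i [:: d; v] set_to_seq Om (G t, (n, tt))); [exact: (Hi (n, t))| |exact: GE].
apply: kleene_args_cons; first by move=> [q []]; apply: (Hd (q, (n, t))).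
by apply: kleene_args_cons (kleene_args_nil _); case; apply: (Hv (n, t)).
Qed.

Lemma dcd_in_jumps C (F : C -> (nat -> nat) -> nat -> nat) (r : C -> nat)
    (q : C -> nat -> nat) :
  has_fun F -> cpt r -> cpt1 q -> dcd (fun t => in_jumps (F t) (r t) (q t)).
Proof.
move=> FC rC qC.
apply: (@dcd_ext _ (fun t => cauchy_name (q t) /\ name01 (q t) /\
  separates (r t) (F t (fun=> 0%N)) (F t (q t)))).
  by move=> t _; split=> [[a []]|[]].
apply: dcd_and; first exact: dcd_cauchy_name.
apply: dcd_and; first exact: dcd_name01.
apply: dcd_separates => //; apply: cpt1_fun => //; exact: cpt_const.
Qed.

Lemma dcd_rat_jump C (F : C -> (nat -> nat) -> nat -> nat) (r : C -> nat) :
  @has_fun C F -> cpt r -> dcd (fun t => rat_jump (F t) (r t)).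
Proof.
move=> FC /cpt1_cst rC.
apply: dcd_and; first exact: dcd_name01.
by apply: dcd_name_neq; apply: cpt1_fun => //; exact: cpt_const.
Qed.

Lemma cpt1_component C (g : C -> nat -> nat) i :
  cpt1 g -> cpt i -> cpt1 (fun t => component (g t) (i t)).
Proof.
move=> gC iC; apply: (cpt_app (cpt1_weak nat_arg gC)).
by apply: cpt_code2; [exact: cpt_weak|exact: cpt_head].
Qed.

Definition tame (F : (nat -> nat) -> nat -> nat) := exists f : R -> R,
  [/\ names_fun01 F f, bounded_variation 0 1 f & rat_constant f].

(** The step of the recursion: the answer at [p] is computed from the answers at the jumps below
    [p], which the last hypothesis provides. *)
Lemma dcd_below_step C (F : C -> (nat -> nat) -> nat -> nat) (r : C -> nat)
    (p : C -> nat -> nat) :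
  has_Omega C -> has_fun F -> cpt r -> cpt1 p ->
  (forall t, dom t -> tame (F t)) ->
  (forall t, dom t -> exists x : R, names_real (p t) x) ->
  @dcd (@subctx (consF C)
      (fun x => in_jumps (F x.2) (r x.2) x.1 /\ name_lt x.1 (p x.2)))
    (fun x => below (F x.2) (r x.2) x.1) ->
  dcd (fun t => below (F t) (r t) (p t)).
Proof.
move=> OC FC rC pC tF pN belowC.
pose T (t : C) q := in_jumps (F t) (r t) q /\ name_lt q (p t).
(* Membership in [T] is tested first, because [below] is available only there. On names, [G] is the
   characteristic function of the set that holds the least jump if it lies below [p]. *)
pose G t q := if `[< T t q >] then
  (if `[< ~ below (F t) (r t) q >] then 1%N else 0%N) else 0%N.
pose g t n := odflt 0%N (Om (G t) n).
have TC : @dcd (consF C) (fun x => T x.2 x.1).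
  apply: dcd_and; last by apply: dcd_name_lt; [exact: cpt1_var|exact: cpt1_weak].
  apply: (@dcd_in_jumps (consF C) (fun x => F x.2) (fun x => r x.2) fst).
  - exact: has_fun_extend.
  - exact: cpt_weak.
  - exact: cpt1_var.
have GC : @cpt (consF C) (fun x => G x.2 x.1).
  apply: (@cpt_if (consF C) (fun x => T x.2 x.1)) => //; last exact: cpt_const.
  apply: cpt_ext belowC => x _.
  by case: asboolP => b; case: asboolP => // ?; exfalso; auto.
have gP t : dom t -> (forall n, Om (G t) n = Some (g t n)) /\
    (below (F t) (r t) (p t) <-> exists i, (i < g t 0%N)%N /\ T t (component (g t) i)).
  move=> Dt; have [f [Ff bvf fc]] := tF t Dt; have [x px] := pN t Dt.
  pose X := [set y | [/\ jumps f (r t) y, y < x &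
    ~ exists z, jumps f (r t) z /\ z < y]].
  have TP q y : names_real q y -> T t q <-> jumps f (r t) y /\ y < x.
    by move=> qy; rewrite /T (in_jumpsP (r t) Ff qy) (name_ltP qy px).
  have X01 : X `<=` `[0, 1] by move=> y [[y01 _] _ _]; rewrite /= in_itv.
  have X1 : is_subset1 X.
    move=> y z [Xy yx Ny] [Xz zx Nz]; apply/eqP; case: ltgtP => // [yz|zy]; exfalso.
      by apply: Nz; exists y.
    by apply: Ny; exists z.
  have GX : names_set01 (G t) X.
    move=> q y _ qy; rewrite /G; case: asboolP => [/(TP q y qy)[Xy yx]|NT]; last first.
      case: asboolP => // -[Xy yx _]; exfalso; apply: NT; exact/(TP q y qy).
    have -> : `[< ~ below (F t) (r t) q >] = `[< X y >]; last by case: asbool.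
    apply: asbool_equiv_eq; rewrite (belowP (r t) Ff qy).
    by split=> [Ny|[]].
  have [g' [s [g'E [[s0 si] Xs]]]] := OmP X01 X1 GX.
  have gE : g t = g' by apply/funext => n; rewrite /g g'E.
  split; first by move=> n; rewrite gE.
  rewrite gE code_nil in s0 *; rewrite (belowP (r t) Ff px); split.
    (* A jump below [p] has the least jump at or below it, and Omega must list that one. *)
    move=> [y [Xy yx]]; have [z [Xz zy Nz]] := jumps_least bvf fc Xy.
    have zx := le_lt_trans zy yx.
    have /Xs /= zs : X z by split.
    exists (index z s); rewrite s0 index_mem zs; split=> //.
    have gz : names_real (component g' (index z s)) z.
      by rewrite -[X in names_real _ X](nth_index 0 zs); apply: si; rewrite index_mem.
    exact/(TP _ _ gz).
  move=> [i []]; rewrite s0 => /si gi /(TP _ _ gi); by exists s`_i.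
have gC : cpt1 g by apply: (cpt1_Omega OC GC) => t /gP[].
apply: (@dcd_ext _ (fun t => exists i, (i < g t 0%N)%N /\ T t (component (g t) i))).
  by move=> t /gP[_ H]; split=> /H.
apply: (@dcd_ex C (fun t i => (i < g t 0%N)%N /\ T t (component (g t) i))).
have gC' := cpt1_weak nat_arg gC.
have cC := cpt1_component gC' (@cpt_head C).
apply: dcd_and.
  apply: dcd_leq; first by apply: cpt_succ; exact: cpt_head.
  by apply: (cpt_app gC'); exact: cpt_const.
apply: dcd_and; last by apply: dcd_name_lt => //; exact: cpt1_weak.
apply: (@dcd_in_jumps (consN C) (fun x => F x.2) (fun x => r x.2)) => //.
  exact: has_fun_extend.
exact: cpt_weak.
Qed.

(** The recursion runs over jumps only, while [p] need not be one: the step is applied once at [p]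
    and, with the self-call supplying the smaller answers, at each jump. *)
Lemma dcd_below C (F : C -> (nat -> nat) -> nat -> nat) (r : C -> nat)
    (p : C -> nat -> nat) :
  has_Omega C -> has_fun F -> cpt r -> cpt1 p ->
  (forall t, dom t -> tame (F t)) ->
  (forall t, dom t -> exists x : R, names_real (p t) x) ->
  dcd (fun t => below (F t) (r t) (p t)).
Proof.
move=> OC FC rC pC tF pN; apply: dcd_below_step => //.
pose D (x : (nat -> nat) * C) := in_jumps (F x.2) (r x.2) x.1.
pose lt (t : C) (a b : nat -> nat) := name_lt a b.
pose val (x : (nat -> nat) * C) :=
  if `[< below (F x.2) (r x.2) x.1 >] then 0%N else 1%N.
suff [e He] : @cpt (@subctx (consF C) D) val.
  by exists e => x [Dx [Xx _]]; apply: He.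
apply: (@cpt_fix C _ _ D lt); last first.
  move=> q t Dt Dq; have [f [Ff bvf fc]] := tF t Dt.
  exact: in_jumps_acc Ff bvf fc Dq.
set RC := rec_ctx _ _ _ _.
suff : @dcd RC (fun x => below (F x.2.2) (r x.2.2) x.2.1) by [].
apply: (@dcd_below_step RC (fun x => F x.2.2) (fun x => r x.2.2) (fun x => x.2.1)).
- by have [i Hi] := OC; exists i.+2 => -[m [q t]]; exact: Hi.
- by have [i Hi] := FC; exists i.+2 => -[m [q t]]; exact: Hi.
- have [e He] := @cpt_weak2 C _ (@total_arg ty1) _ nat_arg _ rC.
  by exists e => -[m x] [[/= Dx _] _]; exact: (He (m, x)).
- have [e He] := @cpt1_weak (consF C) _ nat_arg _ (@cpt1_var C).
  by exists e => -[n [m x]] [[/= Dx _] _]; exact: (He (n, (m, x))).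
- by move=> [m [q t]] [[/= Dt _] _]; exact: tF.
- move=> [m [q t]] [[/= Dt [qC _ _]] _]; exact: cauchy_nameP.
have [e He] := @cpt_self C (nat -> nat) (@total_arg ty1) D lt val.
by exists e => x Dx; exact: (He x Dx).
Qed.

End Programs.

(** * The separator *)

Definition least (P : nat -> Prop) : nat :=
  xget 0%N [set n | P n /\ forall m, P m -> (n <= m)%N].

Lemma leastP (P : nat -> Prop) : (exists n, P n) ->
  P (least P) /\ forall m, P m -> (least P <= m)%N.
Proof.
move=> [n Pn]; apply: (@xgetPex _ 0%N [set n | P n /\ forall m, P m -> (n <= m)%N]).
have ex : exists n, `[< P n >] by exists n; exact/asboolP.
case: (ex_minnP ex) => m /asboolP Pm m_min; exists m; split=> // k Pk.
exact/m_min/asboolP.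
Qed.

Lemma cpt_least (C : ctx) (P : C -> nat -> Prop) :
  @dcd (consN C) (fun t => P t.2 t.1) ->
  (forall t, dom t -> exists n, P t n) -> cpt (fun t => least (P t)).
Proof. by move=> PC Pex; apply: (cpt_mu PC) => t Dt; exact/leastP/Pex. Qed.

Lemma cpt_dyadic (C : ctx) (j n : C -> nat) :
  cpt j -> cpt n -> cpt (fun t => dyadic (j t) (n t)).
Proof.
move=> jC nC; apply: cpt_code3 => //; first exact: cpt_const.
by apply: cpt_pred; exact: cpt_exp2.
Qed.

(** This bound exceeds all of [0, 1], so [below] it says just that there is a jump. *)
Definition two : nat := code [:: 2%N].

(** A rational jump gives a constant name. Otherwise the least jump for the first [r] that has one
    is approximated from below: the numerator at stage [n] is the least [j] with a jump below
    [(j + 1) / 2 ^ n]. The final 0 is for constant functions. *)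
Definition separating_name (F : (nat -> nat) -> nat -> nat) (n : nat) : nat :=
  if `[< exists r, rat_jump F r >] then least (rat_jump F)
  else if `[< exists r, below F r (fun=> two) >] then
    dyadic (least (fun j => below F (least (fun r => below F r (fun=> two)))
                              (fun=> dyadic j.+1 n))) n
  else 0%N.

Section Separator.
Variable R : realType.

Definition separator_dom (F : (nat -> nat) -> nat -> nat) : Prop :=
  exists f : R -> R, names_fun01 F f /\ bounded_variation 0 1 f.

(** Component 0 names the point found; all other components are constantly zero, so the second point
    is 0. *)
Definition separator : partial fun_to_seq := fun F k =>
  if `[< separator_dom F >] then
    Some (if `[< hd k = 0%N >] then separating_name F (hd (tl k)) else 0%N)
  else None.

Lemma dec_rat_surj (s : rat) : exists r, dec_rat r = s.
Proof.
have [m [n mn]] : exists m n : nat, numq s = m%:Z - n%:Z.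
  case: (numq s) => k; first by exists k, 0%N; rewrite subr0.
  by exists 0%N, k.+1; rewrite NegzE sub0r.
exists (code [:: m; n; `|denq s|.-1]%N).
rewrite dec_ratE !(hd_code, tl_code) prednK ?absz_gt0 ?denq_neq0//.
rewrite -[RHS]divq_num_den mn rmorphB /= !pmulrn.
by congr (_ / _); rewrite gez0_abs// denq_ge0.
Qed.

Lemma rat_jumpP F (f : R -> R) r : names_fun01 F f ->
  rat_jump F r <-> 0 <= (ratr (dec_rat r) : R) <= 1 /\ f 0 <> f (ratr (dec_rat r)).
Proof.
move=> Ff; have rr := names_cst R r; rewrite /rat_jump (name01P rr).
have F0 : names_real (F (fun=> 0%N)) (f 0).
  by apply: Ff (names_zero R); rewrite lexx ler01.
by split=> -[r01]; move/(name_neqP F0 (Ff _ _ r01 rr)).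
Qed.

Lemma tameP F (f : R -> R) : names_fun01 F f -> bounded_variation 0 1 f ->
  ~ (exists r, rat_jump F r) -> rat_constant f.
Proof.
move=> Ff bvf NJ s s01; apply: contrapT => fs; apply: NJ.
have [r rs] := dec_rat_surj s; exists r; apply/(rat_jumpP r Ff).
by rewrite rs; split=> // f0; apply: fs.
Qed.

Lemma names_two : names_real (fun=> two) (2%:R : R).
Proof. by have := names_cst R two; rewrite dec_code1 ratr_nat. Qed.

(** Each branch of [separating_name] is computed in the subcontext where its condition holds; there
    its searches terminate and [dcd_below] applies. *)
Lemma separator_computable (Om : partial set_to_seq) : is_Omega R Om ->
  computable_in separator [:: Arg Om; exists2_arg].
Proof.
move=> OmP; pose orc := [:: Arg Om; exists2_arg].
have sz (xi : vals fun_to_seq) : size (args_of xi ++ orc) = 4 by case: xi => F [k []].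
have e2 : exists i, forall xi : vals fun_to_seq,
    onth (args_of xi ++ orc) i = Some exists2_arg.
  by exists 3 => -[F [k []]].
pose C := @Ctx (vals fun_to_seq) (fun xi => separator_dom xi.1)
  (fun xi => args_of xi ++ orc) 4 sz e2.
have OC : has_Omega Om C by exists 2 => -[F [k []]].
have FC : @has_fun C fst by exists 0 => -[F [k []]].
have kC : @cpt C (fun xi => xi.2.1) by apply: (@cpt_arg C _ 1) => -[F [k []]].
suff : @cpt C (fun xi => if `[< hd xi.2.1 = 0%N >]
    then separating_name xi.1 (hd (tl xi.2.1)) else 0%N).
  move=> [e He]; exists e => -[F [k []]] a /=; rewrite /separator.
  by case: asboolP => // DF [<-]; exact: (He (F, (k, tt))).
have nC : @cpt C (fun xi => hd (tl xi.2.1)) by apply: cpt_hd; exact: cpt_tl.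
apply: cpt_if.
- by apply: dcd_eqn (cpt_const _ _); exact: cpt_hd.
- apply: cpt_restrict.
  have JC : @dcd (consN C) (fun t => rat_jump t.2.1 t.1).
    apply: (@dcd_rat_jump (consN C) (fun t => t.2.1)); last exact: cpt_head.
    by exists 1 => -[n [F [k []]]].
  apply: (@cpt_if C (fun xi => exists r, rat_jump xi.1 r)).
  + exact: (@dcd_ex C (fun xi r => rat_jump xi.1 r)).
  + set C1 := subctx _.
    apply: (@cpt_least C1 (fun xi => rat_jump xi.1)); last by move=> xi [].
    have [e He] := JC; exists e => -[n xi] [Dxi _]; exact: (He (n, xi)).
  set C' := subctx _.
  have C't (t : C') : dom t -> tame R t.1.
    by move=> [[f [Ff bvf]] NJ]; exists f; split=> //; exact: tameP Ff bvf NJ.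
  have FC' : @has_fun C' fst by exact: FC.
  have OC' : has_Omega Om C' by exact: OC.
  have BC : @dcd (consN C') (fun t => below t.2.1 t.1 (fun=> two)).
    apply: (@dcd_below R Om OmP (consN C') (fun t => t.2.1) (fun t => t.1)
      (fun _ _ => two)).
    - exact: has_Omega_extend.
    - exact: (has_fun_extend _ FC').
    - exact: cpt_head.
    - exact: cpt_const.
    - by move=> t; exact: C't.
    - by move=> t _; exists 2%:R; exact: names_two.
  apply: (@cpt_if C' (fun xi => exists r, below xi.1 r (fun=> two))).
  + exact: (@dcd_ex C' (fun xi r => below xi.1 r (fun=> two))).
  + set C2 := subctx _.
    have rC : @cpt C2 (fun xi => least (fun r => below xi.1 r (fun=> two))).
      apply: (@cpt_least C2 (fun xi r => below xi.1 r (fun=> two)));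
        last by move=> xi [].
      by have [e He] := BC; exists e => -[n xi] [Dxi _]; exact: (He (n, xi)).
    have n2C : @cpt C2 (fun xi => hd (tl xi.2.1)) by do 2 apply: cpt_restrict.
    apply: cpt_dyadic => //.
    apply: (@cpt_least C2 (fun xi j => below xi.1 _ (fun=> dyadic j.+1 _))).
      apply: (@dcd_below R Om OmP (consN C2) (fun t => t.2.1)
        (fun t => least (fun r => below t.2.1 r (fun=> two)))
        (fun t _ => dyadic t.1.+1 (hd (tl t.2.2.1)))).
      - exact: has_Omega_extend.
      - exact: (has_fun_extend _ (FC : @has_fun C2 fst)).
      - exact: (cpt_weak _ rC).
      - apply: cpt1_cst; apply: cpt_dyadic; first by apply: cpt_succ; exact: cpt_head.
        exact: (cpt_weak _ n2C).
      - by move=> t [Dt _]; exact: C't.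
      - move=> t _; exists (ratr (dec_rat (dyadic t.1.+1 (hd (tl t.2.2.1))))).
        exact: names_cst.
    (* The search for the numerator terminates: a jump [x] exists, and its own digit [j] satisfies
       [x < (j + 1) / 2 ^ n]. *)
    move=> xi [[[f [Ff bvf]] _] /leastP[+ _]].
    rewrite (belowP _ Ff names_two) => -[x [Xx _]].
    have [j /andP[_ jx]] : exists j, digit x (hd (tl xi.2.1)) j.
      by apply: digit_exists; case: Xx => /andP[].
    exists j; apply/(belowP _ Ff (names_cst R _)); exists x; split=> //.
    by rewrite dec_dyadic ratr_frac.
  exact: cpt_const.
exact: cpt_const.
Qed.

(** If [f] is constant on [0, 1], all sums in [AC01] vanish, and [N = 0] serves for every [k]. *)
Lemma not_AC_nonconstant (f : R -> R) : ~ AC01 f -> exists x, 0 <= x <= 1 /\ f 0 <> f x.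
Proof.
move=> NAC; apply: contrapT => Nx; apply: NAC => k; exists 0%N => n x y xy _ _.
have fE z : 0 <= z <= 1 -> f z = f 0.
  by move=> z01; apply: contrapT => fz; apply: Nx; exists z; split=> // f0; apply: fz.
rewrite big1 ?invr_gt0 ?exprn_gt0// => i _; have [x0 [lt_xy y1]] := xy i.
by rewrite !fE ?subrr ?normr0//; apply/andP; split; lra.
Qed.

Lemma separating_nameP F (f : R -> R) : names_fun01 F f -> bounded_variation 0 1 f ->
  exists x, [/\ names_real (separating_name F) x, 0 <= x <= 1
    & ~ AC01 f -> f x <> f 0].
Proof.
move=> Ff bvf; rewrite /separating_name.
case: asboolP => [/leastP[+ _]|NJ].
  move=> /(rat_jumpP _ Ff)[r01 fr]; exists (ratr (dec_rat (least (rat_jump F)))).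
  by split=> [||_ f0]; [exact: names_cst| |apply: fr].
have fc := tameP Ff bvf NJ.
case: asboolP => [/leastP[+ _]|NB]; last first.
  exists 0; split; [exact: names_zero|by rewrite lexx ler01|].
  move=> /not_AC_nonconstant[x [x01 fx]]; exfalso; apply: NB.
  (* A rational strictly between [f 0] and [f x] has a code [r] for which [x] is a jump. *)
  have [s [r sr ss]] : exists2 s, exists r, dec_rat r = s &
      separates_real (ratr s) (f 0) (f x).
    have /eqP := fx; rewrite neq_lt => /orP[] /rat_in_itvoo[s]; rewrite in_itv /= => H;
      exists s; by [exact: dec_rat_surj|left|right].
  exists r; apply/(belowP r Ff names_two); exists x; split; last by move: x01; lra.
  by split=> //; rewrite sr.
set r := least _ => /(belowP r Ff names_two)[x0 [Xx0 _]].
have [x [Xx _ Nx]] := jumps_least bvf fc Xx0.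
have x01 : 0 <= x <= 1 by case: Xx.
exists x; split=> //; last first.
  move=> _ fx; case: Xx => _; rewrite fx => -[] /andP[a b].
    by have := lt_trans a b; rewrite ltxx.
  by have := lt_trans a b; rewrite ltxx.
(* Since [x] is the least jump, some jump lies below a given bound exactly when [x] does. *)
have bE n j : below F r (fun=> dyadic j.+1 n) <-> x < j.+1%:R / 2%:R ^+ n.
  rewrite (belowP r Ff (names_cst R _)) dec_dyadic ratr_frac.
  split=> [[y [Xy yj]]|xj]; last by exists x.
  apply: le_lt_trans yj; rewrite leNgt; apply/negP => yx; apply: Nx; by exists y.
apply: names_digits => n.
have [|] := @leastP (fun j => below F r (fun=> dyadic j.+1 n)).
  have [|j /andP[_ jx]] := @digit_exists _ x n; first by case/andP: x01.
  by exists j; apply/bE.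
set j := least _ => /bE xj jmin; rewrite /digit xj andbT.
(* For [j = 0] the lower bound is [0 <= x]; otherwise minimality of [j] rules out
   [x < j / 2 ^ n]. *)
case: (j) jmin => [|i] jmin; first by rewrite mul0r; case/andP: x01.
rewrite leNgt; apply/negP => /bE /jmin; by rewrite ltnn.
Qed.

Lemma separatorP : singular_BV_separator R separator.
Proof.
move=> f F Ff bvf _; have [x [nx x01 fx]] := separating_nameP Ff bvf.
pose g k := if `[< hd k = 0%N >] then separating_name F (hd (tl k)) else 0%N.
have g0 : component g 0 = separating_name F.
  by apply/funext => n; rewrite /component /g tl_code !hd_code; case: asboolP.
have g1 : component g 1 = fun=> 0%N.
  by apply/funext => n; rewrite /component /g hd_code; case: asboolP.
exists g, x, 0; split=> //.
- by move=> k; rewrite /separator; case: asboolP => // -[]; exists f.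
- by split; [rewrite g0|rewrite g1; exact: names_zero].
- by rewrite lexx ler01.
Qed.

End Separator.

(** * Indicator functions of sets with at most one element *)

Section Indicator.
Variables (R : realType) (X : set R).
Hypothesis X1 : is_subset1 X.

Let ind (x : R) : R := (nat_of_bool `[< X x >])%:R.

Let subset1_cases : X = set0 \/ exists a, X = [set a].
Proof.
have [[a Xa]|NX] := pselect (exists a, X a); [right; exists a|left].
  by apply/seteqP; split=> [b Xb|b ->//]; exact: X1.
by apply/seteqP; split=> // b Xb; apply: NX; exists b.
Qed.

Lemma subset1_indicator_BV : bounded_variation 0 1 ind.
Proof.
have BVn (g : R -> R) : {homo g : x y / x <= y} -> bounded_variation 0 1 g.
  by move=> gn; apply: nondecreasing_bounded_variation => x y _ _; exact: gn.
have [X0|[a Xa]] := subset1_cases.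
  apply: BVn => x y _; rewrite /ind X0.
  by case: asboolP => //; case: asboolP.
(* The indicator of a point is the difference of those of the closed and the open half-line starting
   there, both nondecreasing. *)
pose g1 (x : R) : R := (nat_of_bool (a <= x))%:R.
pose g2 (x : R) : R := (nat_of_bool (a < x))%:R.
have -> : ind = g1 \+ (\- g2).
  apply/funext => x; rewrite /ind Xa /g1 /g2 /=.
  case: asboolP => [->|/eqP]; first by rewrite lexx ltxx subr0.
  by rewrite eq_sym le_eqVlt => /negPf->; rewrite subrr.
apply: bounded_variationD; first exact: ltr01.
  apply: BVn => x y xy; rewrite /g1 ler_nat; case: (leP a x) => // ax.
  by rewrite (le_trans ax xy).
apply: bounded_variationN; apply: BVn => x y xy; rewrite /g2 ler_nat.
by case: (ltP a x) => // ax; rewrite (lt_le_trans ax xy).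
Qed.

(** The set [X] is closed and null, and off it the indicator vanishes locally. *)
Lemma subset1_indicator_singular : singular01 ind.
Proof.
exists X; split.
- have [->|[a ->]] := subset1_cases; first exact: measurable0.
  exact: measurable_set1.
- by have [->|[a ->]] := subset1_cases; [exact: measure0|exact: lebesgue_measure_set1].
move=> x /= Hx; apply: contrapT => Xx; apply: Hx => _.
have cX : closed X.
  by have [->|[a ->]] := subset1_cases; [exact: closed0|exact: closed_eq].
apply: (@near_eq_is_derive _ _ _ (cst 0)).
have : nbhs x (~` X) by apply: open_nbhs_nbhs; split=> //; exact: closed_openC.
by apply: filterS => y Xy; rewrite /ind; case: asboolP.
Qed.

(** An arbitrarily short interval with end point [a] already contributes 1 to the sum, which defeats
    [k = 1]. *)
Lemma subset1_indicator_not_AC a : 0 <= a <= 1 -> X a -> ~ AC01 ind.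
Proof.
move=> /andP[a0 a1] Xa /(_ 1%N)[N HN].
have ind_a : ind a = 1 by rewrite /ind; case: asboolP.
have ind_n x : x != a -> ind x = 0.
  by rewrite /ind; case: asboolP => // Xx /eqP[]; exact: X1.
have [e [e0 eN e2]] : exists e : R, [/\ 0 < e, e < 2%:R ^- N & e < 2%:R^-1].
  (* This length is below [2 ^- N] and below one half, so such an interval fits to the right of [a]
     if [a] is at most one half, and to the left otherwise. *)
  exists (2%:R ^- N.+2); rewrite invr_gt0 exprn_gt0//; split=> //.
    by rewrite ltf_pV2 ?posrE ?exprn_gt0// -!natrX ltr_nat ltn_exp2l// ltnW.
  by rewrite ltf_pV2 ?posrE ?exprn_gt0// -natrX ltr_nat expnS ltn_Pmulr// expnS; lia.
have [y [z [yz y0 z1 yzE fyz]]] : exists y z : R,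
    [/\ y < z, 0 <= y, z <= 1, z - y = e & `|ind z - ind y| = 1].
  have [a2|a2] := leP a 2%:R^-1.
    exists a, (a + e); rewrite ind_a ind_n ?sub0r ?normrN1;
      last by rewrite gt_eqF// ltrDl.
    by split=> //; lra.
  exists (a - e), a; rewrite ind_a ind_n ?subr0 ?normr1; last by rewrite lt_eqF// gtrBl.
  by split=> //; lra.
have : \sum_(i < 1) `|ind z - ind y| < 2%:R ^- 1.
  apply: (HN 1%N (fun=> y) (fun=> z)) => //.
  - by move=> i j _ _ _; rewrite !ord1.
  - by rewrite big_ord1 yzE.
by rewrite big_ord1 fyz expr1; lra.
Qed.

End Indicator.

(** * Omega from an arbitrary separator *)

Lemma Omega_from_separator (R : realType) (Phi : partial fun_to_seq) :
  singular_BV_separator R Phi -> Omega_computable_in R Phi.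
Proof.
move=> PhiP.
(* On names this codes the indicator function, its values being the constant names of 0 and 1. *)
pose G (F : (nat -> nat) -> nat) (q : nat -> nat) (n : nat) : nat :=
  if `[< F q = 0%N >] then 0%N else code [:: 1%N].
(* Place 0 is [code [::]] and holds the length 2; elsewhere the output of [Phi] is kept, whose two
   components become the entries of the list. *)
pose Om : partial set_to_seq := fun F n =>
  if `[< n = 0%N >] then Some 2%N else Phi (G F) n.
exists Om; split.
  move=> X F X01 X1 FX; pose f (x : R) : R := (nat_of_bool `[< X x >])%:R.
  have Gf : names_fun01 (G F) f.
    move=> q x x01 qx; rewrite /G (FX q x x01 qx) /f.
    case: (asboolP (X x)) => _; case: asboolP => // _.
      exact: names_one.
    exact: names_zero.
  have [g [x [y [PhiE [gx gy] x01 y01 fxy]]]] :=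
    PhiP f (G F) Gf (subset1_indicator_BV X1) (subset1_indicator_singular X1).
  exists (fun n => if `[< n = 0%N >] then 2%N else g n), [:: x; y]; split.
    by move=> n; rewrite /Om; case: asboolP.
  have compE i :
      component (fun n => if `[< n = 0%N >] then 2%N else g n) i = component g i.
    apply/funext => n; rewrite /component code_cons; case: asboolP => // /eqP.
    by rewrite muln_eq0 expn_eq0 /= addn1.
  split.
    split; first by rewrite code_nil; case: asboolP.
    by case=> [|[|//]] _; rewrite compE.
  move=> a Xa /=; have a01 : 0 <= a <= 1 by have := X01 a Xa; rewrite /= in_itv.
  (* The indicator takes different values at the two points, so one of them lies in [X] and equals
     [a]. *)
  have fxy' := fxy (subset1_indicator_not_AC X1 a01 Xa); rewrite !inE.
  have [//|xa] := eqVneq a x; have [//|ya] := eqVneq a y; exfalso; apply: fxy'.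
  rewrite /f; case: asboolP => [Xx|_]; first by rewrite (X1 _ _ Xa Xx) eqxx in xa.
  by case: asboolP => // Xy; rewrite (X1 _ _ Xa Xy) eqxx in ya.
pose orc := [:: Arg Phi; exists2_arg].
have sz (xi : vals set_to_seq) : size (args_of xi ++ orc) = 4 by case: xi => F [k []].
have e2 : exists i, forall xi : vals set_to_seq,
    onth (args_of xi ++ orc) i = Some exists2_arg.
  by exists 3 => -[F [k []]].
(* The domain consists of the places where [Om] is defined, so the default value in the program
   below is never reached. *)
pose C := @Ctx (vals set_to_seq) (fun xi => Om xi.1 xi.2.1 <> None)
  (fun xi => args_of xi ++ orc) 4 sz e2.
have kC : @cpt C (fun xi => xi.2.1) by apply: (@cpt_arg C _ 1) => -[F [k []]].
suff : @cpt C (fun xi => if `[< xi.2.1 = 0%N >] then 2%N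
    else odflt 0%N (Phi (G xi.1) xi.2.1)).
  move=> [e He]; exists e => -[F [k []]] a /= Ea; have := He (F, (k, tt)).
  have -> : a = if `[< k = 0%N >] then 2%N else odflt 0%N (Phi (G F) k).
    by move: Ea; rewrite /Om; case: asboolP => [_ [->]|_ ->].
  by rewrite /= Ea; apply.
apply: cpt_if; [exact: dcd_eqn kC (cpt_const _ _)|exact: cpt_const|].
have [d Hd] : @cpt (consF (consN C)) (fun x => G x.2.2.1 x.1 x.2.1).
  apply: (@cpt_if (consF (consN C)) (fun x => x.2.2.1 x.1 = 0%N)); try exact: cpt_const.
  apply: dcd_eq0; have [d Hd] := @cpt1_var (consN C).
  exists (code [:: 8; 2; d]%N) => -[q [n [F [k []]]]] Dx.
  apply: (@S8 2 [:: d] [:: ty1] (@to_partial [:: ty1] F) (q, tt)) => //.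
  apply: kleene_args_cons (kleene_args_nil _).
  by move=> [m []]; apply: (Hd (m, (q, (n, (F, (k, tt)))))).
have [v Hv] := kC.
exists (code [:: 8; 2; d; v]%N) => -[F [k []]] [/= Dx k0].
apply: (@S8 2 [:: d; v] fun_to_seq Phi (G F, (k, tt))) => //; last first.
  move: Dx; rewrite /Om; case: asboolP => //= _.
  by case: (Phi _ _).
apply: kleene_args_cons; first by move=> [q [n []]]; apply: (Hd (q, (n, (F, (k, tt))))).
by apply: kleene_args_cons (kleene_args_nil _); case; apply: (Hv (F, (k, tt))).
Qed.

Theorem theorem4p26 (R : realType) :
  class_in_Omega_cluster R (@singular_BV_separator R).
Proof.
split; first exact: Omega_from_separator.
exists (separator R); first exact: separatorP.
split=> //; first exact: separator_computable.
exact/Omega_from_separator/separatorP.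
Qed.
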